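(* Assume the Linearization Conjecture (stated in the context, for the given $n$ and $L$). Let $\mu=(\mu^{(1)},\ldots,\mu^{(n)})$ satisfy $p^{(a)}_i\ge1$ for all $(a,i)\in\overline H$, let $p\in{\mathcal P}(\mu)$ and $l\ge1$, and let ${\mathcal N}^{(1)}_l$ be the smallest positive integer with $(T^{(1)}_l)^{{\mathcal N}^{(1)}_l}(p)=p$. Let $y_{k,a}(t)$ denote the number of balls of color $a$ (letters $a$) in the carrier of type $B^{1,l}$ at position $k$ for the path $(T^{(1)}_l)^t(p)$ (see the context), and $\langle y_{k,a}\rangle_l=\frac{1}{{\mathcal N}^{(1)}_l}\sum_{t=0}^{{\mathcal N}^{(1)}_l-1}y_{k,a}(t)$. Then $$\langle y_{k,a}\rangle_l={}^t{\bf h}^{(1)}_lB^{-1}\bigl({\bf h}^{(a-1)}_\infty-{\bf h}^{(a)}_\infty\bigr)\qquad(2\le a\le n+1).$$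
   Context: Fix integers $n\ge 1$, $L\ge 1$. For $1\le r\le n$, $l\ge 1$, let $B^{r,l}$ be the set of semistandard tableaux of rectangular shape with $r$ rows and $l$ columns and entries in $\{1,\ldots,n+1\}$; so $B^{1,1}=\{1,\ldots,n+1\}$. For a semistandard tableau $T$ and a letter $x$, $T\leftarrow x$ denotes Schensted row insertion ($x$ bumps the smallest entry of the first row strictly larger than $x$, the bumped entry is inserted into the next row, and so on; if there is no such entry the letter is appended at the end of the row), and $x\rightarrow T$ denotes column insertion ($x$ bumps the smallest entry of the first column that is $\ge x$, the bumped entry is inserted into the next column, and so on; if there is no such entry the letter is appended at the bottom of the column). The combinatorial $R$ is the bijection $R:B^{r,l}\otimes B^{1,1}\to B^{1,1}\otimes B^{r,l}$ ($\otimes$ is a formal Cartesian product) determined by $R(b\otimes c)=c'\otimes b'$ iff $(c\rightarrow b)=(b'\leftarrow c')$; we also write $b\otimes c\simeq c'\otimes b'$. The local energy $H(b\otimes c)$ is $0$ if this common tableau has shape $(l+1,l^{r-1})$ and $1$ if it has shape $(l^r,1)$. A path is an element $p=b_1\otimes\cdots\otimes b_L$ of $B=(B^{1,1})^{\otimes L}$, also written as a word $b_1\ldots b_L$. For $v\in B^{r,l}$ put $v_0=v$ and recursively $v_{k-1}\otimes b_k\simeq b'_k\otimes v_k$, $e_k=H(v_{k-1}\otimes b_k)$ for $k=1,\ldots,L$ ($v_k$ is the carrier at position $k$); write $v'(v;p)=v_L$, $p'(v;p)=b'_1\otimes\cdots\otimes b'_L$, $e_k(v;p)=e_k$. The path $p$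 is $T^{(r)}_l$-evolvable if there is $v\in B^{r,l}$ with $v=v'(v;p)$ and, moreover, $p'(v;p)$ and all $e_k(v;p)$ are the same for all such $v$. Then $T^{(r)}_l(p)=p'(v;p)$ and $E^{(r)}_l(p)=\sum_{k=1}^L e_k(v;p)$. A path is evolvable if it is $T^{(r)}_l$-evolvable for all $1\le r\le n$, $l\ge1$. For an $n$-tuple of Young diagrams $\mu=(\mu^{(1)},\ldots,\mu^{(n)})$, let $l^{(a)}_1>\cdots>l^{(a)}_{g_a}\ge 1$ be the distinct row lengths of $\mu^{(a)}$ and $m^{(a)}_i\ge1$ the number of rows of length $l^{(a)}_i$. Put $\overline H=\{(a,i)\mid 1\le a\le n,\ 1\le i\le g_a\}$, $H=\{(a,i,\alpha)\mid (a,i)\in\overline H,\ 1\le\alpha\le m^{(a)}_i\}$, $G=|H|$. Let $(C_{ab})_{1\le a,b\le n}$, $C_{ab}=2\delta_{ab}-\delta_{a,b+1}-\delta_{a,b-1}$, be the Cartan matrix of $A_n$. The vacancy numbers are $p^{(a)}_i=L\delta_{a1}-\sum_{(b,j)\in\overline H}C_{ab}\min(l^{(a)}_i,l^{(b)}_j)m^{(b)}_j$. A path is highest if for every $1\le j\le L$ the prefix $b_1\ldots b_j$ satisfies $\#(1)\ge\#(2)\ge\cdots\ge\#(n+1)$, where $\#(a)$ is the number of letters $a$. ${\mathcal P}(\mu)$ is the set of evolvable paths $p$ with $\#(1)\ge\#(2)\ge\cdots\ge\#(n+1)$ and $E^{(a)}_l(p)=\sum_{i=1}^{g_a}\min(l,l^{(a)}_i)m^{(a)}_i$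 for all $1\le a\le n$, $l\ge1$; ${\mathcal P}_+(\mu)$ is the set of highest paths in ${\mathcal P}(\mu)$. A rigged configuration $(\mu,{\bf r})$ is $\mu$ with an integer array ${\bf r}=(r^{(a)}_{i,\alpha})_{(a,i,\alpha)\in H}$ with $0\le r^{(a)}_{i,1}\le\cdots\le r^{(a)}_{i,m^{(a)}_i}\le p^{(a)}_i$; $\mathrm{RC}(\mu)$ is the set of these. It is viewed as a multiset of strings (color $a$, length $l^{(a)}_i$, rigging $r^{(a)}_{i,\alpha}$). A string is singular if its rigging equals the vacancy number $p^{(a)}_i$. The KKR map $\phi$ from highest paths to rigged configurations is defined by induction on $L$. For $L=0$ the image is empty. Given $\phi(b_1\ldots b_L)$ and $d=b_{L+1}$: if $d=1$, the strings are unchanged (only $L$ is replaced by $L+1$). If $d\ge2$, set $\ell^{(d)}=\infty$ and for $c=d-1,\ldots,1$ in this order select a color $c$ singular string (with respect to the old configuration and $L$) whose length $\ell^{(c)}$ is largest subject to $\ell^{(c)}\le\ell^{(c+1)}$ (any one if several; if none, $\ell^{(c)}=0$). For each $c=1,\ldots,d-1$ replace the selected string by a color $c$ string of length $\ell^{(c)}+1$ (a new length $1$ string if $\ell^{(c)}=0$), with rigging making it singular with respect to the new configuration and $L+1$; other strings are unchanged. One knows $\phi({\mathcal P}_+(\mu))\subseteq\mathrm{RC}(\mu)$. Let $\tilde{\mathcal J}(\mu)$ be the set of integer arrays $(r^{(a)}_{i,\alpha})_{(a,i)\in\overline H,\alpha\in{\mathbb Z}}$ with $r^{(a)}_{i,\alpha}\le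 r^{(a)}_{i,\alpha+1}$ and $r^{(a)}_{i,\alpha+m^{(a)}_i}=r^{(a)}_{i,\alpha}+p^{(a)}_i$. Let $\iota:{\mathcal P}_+(\mu)\to\tilde{\mathcal J}(\mu)$ send $p_+$ with $\phi(p_+)=(\mu,{\bf r})$ to the unique quasi-periodic extension of ${\bf r}$ in $\tilde{\mathcal J}(\mu)$. Let ${\mathcal T}$ be the abelian group generated by all $T^{(a)}_l$ ($1\le a\le n$, $l\ge1$) and ${\mathcal A}$ the free abelian group generated by symbols $s^{(a)}_i$, $(a,i)\in\overline H$. They act (commutatively) on $\tilde{\mathcal J}(\mu)$ by $T^{(a)}_l:(r^{(b)}_{j,\beta})\mapsto(r^{(b)}_{j,\beta}+\delta_{ab}\min(l,l^{(b)}_j))$ and $s^{(a)}_i:(r^{(b)}_{j,\beta})\mapsto(r^{(b)}_{j,\beta+\delta_{ab}\delta_{ij}}+C_{ab}\min(l^{(a)}_i,l^{(b)}_j))$. Put ${\mathcal J}(\mu)=\tilde{\mathcal J}(\mu)/{\mathcal A}$ (set of ${\mathcal A}$-orbits), on which ${\mathcal T}$ acts. Linearization Conjecture: for every $\mu$ with $p^{(a)}_i\ge1$ for all $(a,i)\in\overline H$: (1) $T^{(r)}_l({\mathcal P}(\mu))={\mathcal P}(\mu)$ for all $r,l$ (so ${\mathcal T}$ acts on ${\mathcal P}(\mu)$); (2) every ${\mathcal T}$-orbit in ${\mathcal P}(\mu)$ meets ${\mathcal P}_+(\mu)$; (3) the map $\Phi:{\mathcal P}(\mu)\to{\mathcal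 J}(\mu)$, $\Phi(p)={\mathcal A}\cdot(t\cdot\iota(p_+))$ whenever $p=t\cdot p_+$ with $t\in{\mathcal T}$, $p_+\in{\mathcal P}_+(\mu)$, is well-defined, bijective and commutes with ${\mathcal T}$. Put $B=(\delta_{ab}\delta_{ij}\delta_{\alpha\beta}p^{(a)}_i+C_{ab}\min(l^{(a)}_i,l^{(b)}_j))_{(a,i,\alpha),(b,j,\beta)\in H}$ (the same letter as the set of paths, but here a symmetric positive definite $G\times G$ matrix), $\Theta({\bf z})=-\min_{{\bf n}\in{\mathbb Z}^G}\{\frac12{}^t{\bf n}B{\bf n}+{}^t{\bf z}{\bf n}\}$, ${\bf p}=(p^{(a)}_i)_{(a,i,\alpha)\in H}$, ${\bf h}^{(c)}_l=(\delta_{ac}\min(l,l^{(c)}_i))_{(a,i,\alpha)\in H}$ for $1\le c\le n$, $l\ge1$ or $l=\infty$ (with $\min(\infty,x)=x$), and ${\bf h}^{(n+1)}_l=0$. The carrier: let $(r^{(a)}_{i,\alpha})_{(a,i)\in\overline H,\alpha\in\mathbb Z}\in\tilde{\mathcal J}(\mu)$ represent $\Phi(p)$ and put ${\bf r}=(r^{(a)}_{i,\alpha})_{(a,i,\alpha)\in H}$, ${\bf J}={\bf r}-\frac{\bf p}{2}+t{\bf h}^{(1)}_l$. The carrier $y_k(t)=(y_{k,1}(t),\ldots,y_{k,n+1}(t))\in B^{1,l}$ at position $k$ that satisfies the periodic boundary condition $y_0(t)=y_L(t)$ and induces $T^{(1)}_l$ on $(T^{(1)}_l)^t(p)$ is the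 one with, for $2\le a\le n+1$, $$y_{k,a}(t)=\Theta({\bf J}-k{\bf h}^{(1)}_1+{\bf h}^{(a)}_\infty)-\Theta({\bf J}-k{\bf h}^{(1)}_1+{\bf h}^{(1)}_l+{\bf h}^{(a)}_\infty)-\Theta({\bf J}-k{\bf h}^{(1)}_1+{\bf h}^{(a-1)}_\infty)+\Theta({\bf J}-k{\bf h}^{(1)}_1+{\bf h}^{(1)}_l+{\bf h}^{(a-1)}_\infty),$$ and $y_{k,1}(t)=l-\sum_{a\ge2}y_{k,a}(t)$. *)

(* Defs.v *)
From mathcomp Require Import all_boot all_order all_algebra.
From mathcomp Require Import boolp classical_sets.

Set Implicit Arguments.
Unset Strict Implicit.
Unset Printing Implicit Defensive.

Import Order.TTheory GRing.Theory Num.Theory.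

Local Open Scope nat_scope.

(* Letters, colors, row numbers r and column numbers l are natural numbers
   counted from 1, as in the mathematics; only the finite index types 'I_k
   used inside Hbar and H count from 0. *)

(* A tableau is the list of its rows, from top to bottom. *)
Definition tableau := seq (seq nat).

Definition conj_tab (T : tableau) : tableau :=
  [seq [seq nth 0 row j | row <- T & j < size row]
     | j <- iota 0 (size (head [::] T))].

(* The bumped entry is the first y of the line with [above x y]; on a sorted
   line this is the smallest such entry. *)
Fixpoint insert (above : rel nat) (T : tableau) (x : nat) : tableau :=
  if T is row :: T' then
    let i := find (above x) row in
    if i < size row
    then set_nth 0 row i x :: insert above T' (nth 0 row i)
    else rcons row x :: T'
  else [:: [:: x]].

(* T <- x *)
Definition row_insert (T : tableau) (x : nat) : tableau := insert ltn T x.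

(* x -> T : the columns of T are the rows of its transpose *)
Definition col_insert (x : nat) (T : tableau) : tableau :=
  conj_tab (insert leq (conj_tab T) x).

Definition letter (n x : nat) : bool := 1 <= x <= n.+1.

Definition semistandard (T : tableau) : bool :=
  all (sorted leq) T && all (sorted ltn) (conj_tab T).

(* T \in B^{r,l} *)
Definition inB (n r l : nat) (T : tableau) : bool :=
  [&& shape T == nseq r l, all (all (letter n)) T & semistandard T].

(* R (b (x) c) = c' (x) b' *)
Definition combR (n r l : nat) (b : tableau) (c c' : nat) (b' : tableau) : bool :=
  [&& inB n r l b, letter n c, letter n c', inB n r l b'
    & col_insert c b == row_insert b' c'].

(* The shape of [col_insert c b] is either (l+1, l^(r-1)) or (l^r, 1). *)
Definition local_energy (r l : nat) (b : tableau) (c : nat) : nat :=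
  if shape (col_insert c b) == l.+1 :: nseq r.-1 l then 0 else 1.

Definition is_path (n L : nat) (p : seq nat) : bool :=
  (size p == L) && all (letter n) p.

(* v 0, ..., v (size p) are the carriers obtained by sending v 0 through p,
   and p' is the output p'(v 0; p). *)
Definition run (n r l : nat) (p p' : seq nat) (v : nat -> tableau) : Prop :=
  [/\ inB n r l (v 0), size p' = size p &
      forall k, k < size p -> combR n r l (v k) (nth 0 p k) (nth 0 p' k) (v k.+1)].

Definition periodic_run (n r l : nat) (p p' : seq nat) (v : nat -> tableau) : Prop :=
  run n r l p p' v /\ v (size p) = v 0.

Definition T_evolvable (n r l : nat) (p : seq nat) : Prop :=
  (exists p' v, periodic_run n r l p p' v) /\
  (forall p1 v1 p2 v2,
     periodic_run n r l p p1 v1 -> periodic_run n r l p p2 v2 ->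
     p1 = p2 /\
     (forall k, k < size p ->
        local_energy r l (v1 k) (nth 0 p k) = local_energy r l (v2 k) (nth 0 p k))).

(* T^(r)_l (p) = p' *)
Definition Tevol (n r l : nat) (p p' : seq nat) : Prop :=
  T_evolvable n r l p /\ exists v, periodic_run n r l p p' v.

(* E^(r)_l (p) = e *)
Definition energy (n r l : nat) (p : seq nat) (e : nat) : Prop :=
  T_evolvable n r l p /\
  exists p' v, periodic_run n r l p p' v /\
    e = \sum_(k < size p) local_energy r l (v k) (nth 0 p k).

Definition evolvable (n : nat) (p : seq nat) : Prop :=
  forall r l, 1 <= r <= n -> 1 <= l -> T_evolvable n r l p.

Definition dominant (n : nat) (p : seq nat) : Prop :=
  forall a, 1 <= a <= n -> count_mem a.+1 p <= count_mem a p.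

Definition highest (n : nat) (p : seq nat) : Prop :=
  forall j, 1 <= j <= size p -> dominant n (take j p).

(* A Young diagram is the list of its row lengths. *)
Definition young (s : seq nat) : bool := sorted geq s && (0 \notin s).

(* The pairs (a, i) *)
Definition Hbar (n : nat) (mu : 'I_n -> seq nat) : finType :=
  {a : 'I_n & 'I_(size (undup (mu a)))}.

Section Index.
Variables (n L : nat) (mu : 'I_n -> seq nat).

Definition color (x : Hbar mu) : nat := (tag x).+1.

(* l^(a)_i *)
Definition len (x : Hbar mu) : nat := nth 0 (undup (mu (tag x))) (tagged x).

(* m^(a)_i *)
Definition mult (x : Hbar mu) : nat := count_mem (len x) (mu (tag x)).

(* The triples (a, i, alpha); alpha = 1, ..., m^(a)_i is (tagged x).+1 *)
Definition H : finType := {x : Hbar mu & 'I_(mult x)}.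

Local Open Scope ring_scope.

Definition cartan (a b : nat) : int :=
  2 * (a == b)%:R - (a == b.+1)%:R - (b == a.+1)%:R.

(* C_ab min(l^(a)_i, l^(b)_j) *)
Definition cmin (x y : Hbar mu) : int :=
  cartan (color x) (color y) * (minn (len x) (len y))%:Z.

Definition vac (x : Hbar mu) : int :=
  L%:Z * (color x == 1%N)%:R - \sum_(y : Hbar mu) cmin x y * (mult y)%:Z.

End Index.

Section Paths.
Variables (n L : nat) (mu : 'I_n -> seq nat).

Definition inP (p : seq nat) : Prop :=
  [/\ is_path n L p, evolvable n p, dominant n p &
      forall (a : 'I_n) l, 1 <= l ->
        energy n a.+1 l p (\sum_(x : Hbar mu | tag x == a) minn l (len x) * mult x)].

Definition inPplus (p : seq nat) : Prop := inP p /\ highest n p.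

End Paths.

Local Open Scope ring_scope.

(* (color, length, rigging) *)
Definition rstring := (nat * nat * int)%type.

(* Vacancy number of a string of color a and length l in the configuration
   with (color, length) pairs [cfg]. *)
Definition cfg_vac (L : nat) (cfg : seq (nat * nat)) (a l : nat) : int :=
  L%:Z * (a == 1%N)%:R - \sum_(s <- cfg) cartan a s.1 * (minn l s.2)%:Z.

(* None stands for infinity. *)
Definition leinf (k : nat) (l : option nat) : bool :=
  if l is Some l' then (k <= l')%N else true.

(* The pairs (c, l^(c)) for c, c - 1, ..., 1, with l^(c+1) = [bound]; the
   maximum over no string is 0. *)
Fixpoint kkr_select (L : nat) (S : seq rstring) (c : nat) (bound : option nat)
    : seq (nat * nat) :=
  if c is c'.+1 then
    let ell := (\max_(s <- S | [&& s.1.1 == c,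
                                  s.2 == cfg_vac L (unzip1 S) c s.1.2
                                & leinf s.1.2 bound]) s.1.2)%N in
    (c, ell) :: kkr_select L S c' (Some ell)
  else [::].

(* phi (b_1 ... b_L d) from S = phi (b_1 ... b_L).  Singular strings of equal
   color and length coincide, so removing one occurrence of it removes "the
   selected string"; nothing is removed when the selected length is 0. *)
Definition kkr_step (L : nat) (S : seq rstring) (d : nat) : seq rstring :=
  let sel := kkr_select L S d.-1 None in
  let kept := foldl (fun S' (s : nat * nat) =>
                rem (s.1, s.2, cfg_vac L (unzip1 S) s.1 s.2) S') S sel in
  let grown := [seq (s.1, s.2.+1) | s <- sel] in
  let cfg := unzip1 kept ++ grown in
  kept ++ [seq (s.1, s.2, cfg_vac L.+1 cfg s.1 s.2) | s <- grown].

Fixpoint kkr_from (L : nat) (S : seq rstring) (p : seq nat) : seq rstring :=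
  if p is d :: p' then kkr_from L.+1 (kkr_step L S d) p' else S.

Definition kkr (p : seq nat) : seq rstring := kkr_from 0 [::] p.

(* Integer arrays (r^(a)_{i,alpha}), alpha running over all integers *)
Definition extrig (n : nat) (mu : 'I_n -> seq nat) := Hbar mu -> int -> int.

(* An element of the abelian group generated by the T^(a)_l, as a word in the letters
   (a, l, true) for T^(a)_l and (a, l, false) for its inverse.  The T^(a)_l
   commute, so words with the same exponents act in the same way. *)
Definition Tword := seq (nat * nat * bool).

Section Rigged.
Variables (n L : nat) (mu : 'I_n -> seq nat).
Implicit Types (rt : extrig mu) (p q : seq nat) (t : Tword).

Definition inJtilde rt : Prop :=
  forall (x : Hbar mu) (alpha : int),
    rt x alpha <= rt x (alpha + 1) /\
    rt x (alpha + (mult x)%:Z) = rt x alpha + vac L x.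

(* The entries with alpha = 1, ..., m^(a)_i belong to RC(mu). *)
Definition window_inRC rt : Prop :=
  forall x : Hbar mu,
    [/\ 0 <= rt x 1,
        forall alpha, (1 <= alpha)%N -> (alpha < mult x)%N ->
          rt x alpha%:Z <= rt x alpha.+1%:Z
      & rt x (mult x)%:Z <= vac L x].

Definition window_strings rt : seq rstring :=
  [seq (color (tag i), len (tag i), rt (tag i) (tagged i).+1%:Z) | i : H mu].

(* iota p = rt, for p a highest path *)
Definition iota_KKR p rt : Prop :=
  [/\ inJtilde rt, window_inRC rt & perm_eq (kkr p) (window_strings rt)].

Definition Tword_wf t : bool :=
  all (fun g => (1 <= g.1.1 <= n)%N && (1 <= g.1.2)%N) t.

(* t . p = q inside P(mu) *)
Fixpoint Tact_path t p q : Prop :=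
  if t is (a, l, pos) :: t' then
    exists p1, [/\ Tact_path t' p p1, inP L mu q
                 & if pos then Tevol n a l p1 q else Tevol n a l q p1]
  else inP L mu p /\ p = q.

Fixpoint Tact t rt : extrig mu :=
  if t is (a, l, pos) :: t' then
    fun x alpha => Tact t' rt x alpha
      + (-1) ^+ (~~ pos) * ((a == color x)%:R * (minn l (len x))%:Z)
  else rt.

(* The action of the product of the (s^(a)_i)^(d (a, i)) *)
Definition Aact (d : {ffun Hbar mu -> int}) rt : extrig mu :=
  fun x alpha => rt x (alpha + d x) + \sum_(y : Hbar mu) d y * cmin y x.

(* rt and rt' represent the same element of J(mu). *)
Definition same_class rt rt' : Prop := exists d, rt' =2 Aact d rt.

(* rt represents Phi(p). *)
Definition Phi p rt : Prop :=
  exists t pplus rt0,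
    [/\ Tword_wf t, inPplus L mu pplus, Tact_path t pplus p,
        iota_KKR pplus rt0 & same_class (Tact t rt0) rt].

Definition LC_stable : Prop :=
  forall r l, (1 <= r <= n)%N -> (1 <= l)%N ->
    (forall p, inP L mu p -> exists2 q, inP L mu q & Tevol n r l p q) /\
    (forall q, inP L mu q -> exists2 p, inP L mu p & Tevol n r l p q).

Definition LC_orbits : Prop :=
  forall p, inP L mu p ->
    exists t pplus, [/\ Tword_wf t, inPplus L mu pplus & Tact_path t pplus p].

Definition Phi_well_defined : Prop :=
  forall p, inP L mu p ->
    (exists rt, Phi p rt) /\
    (forall rt rt', Phi p rt -> Phi p rt' -> same_class rt rt').

Definition Phi_injective : Prop :=
  forall p q rt, inP L mu p -> inP L mu q -> Phi p rt -> Phi q rt -> p = q.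

Definition Phi_surjective : Prop :=
  forall rt, inJtilde rt -> exists2 p, inP L mu p & Phi p rt.

Definition Phi_equivariant : Prop :=
  forall t p q rt, Tword_wf t -> Tact_path t p q -> Phi p rt -> Phi q (Tact t rt).

End Rigged.

Definition young_tuple (n : nat) (mu : 'I_n -> seq nat) : Prop :=
  forall a, young (mu a).

Definition linearization_conjecture (n L : nat) : Prop :=
  forall mu : 'I_n -> seq nat, young_tuple mu ->
    (forall x : Hbar mu, 1 <= vac L x) ->
    [/\ LC_stable L mu, LC_orbits L mu &
        [/\ Phi_well_defined L mu, Phi_injective L mu,
            Phi_surjective L mu & Phi_equivariant L mu]].

Section Theta.
Variables (n L : nat) (mu : 'I_n -> seq nat).

(* The G x G matrices and vectors are indexed by H through its enumeration. *)
Local Notation G := #|H mu|.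

Definition triple (i : 'I_G) : H mu := enum_val i.

Definition Bmx : 'M[rat]_G :=
  \matrix_(i, j)
    let x := triple i in let y := triple j in
    ((i == j)%:R * vac L (tag x) + cmin (tag x) (tag y))%:~R.

Definition theta_form (z : 'cV[rat]_G) (m : 'cV[int]_G) : rat :=
  let x := map_mx intr m in
  (2^-1 *: (x^T *m Bmx *m x) + z^T *m x) 0 0.

(* The minimum exists when Bmx is positive definite. *)
Definition Theta (z : 'cV[rat]_G) : rat :=
  - xget 0 (fun u : rat =>
      (exists m, theta_form z m = u) /\ (forall m, u <= theta_form z m)).

Definition pvec : 'cV[rat]_G := \col_i (vac L (tag (triple i)))%:~R.

(* h^(c)_l, with l = None for infinity; it vanishes for c = n + 1. *)
Definition hvec (c : nat) (l : option nat) : 'cV[rat]_G :=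
  \col_i let x := tag (triple i) in
    ((c == color x) * (if l is Some l' then minn l' (len x) else len x))%:R.

Definition rvec (rt : extrig mu) : 'cV[rat]_G :=
  \col_i let x := triple i in (rt (tag x) (tagged x).+1%:Z)%:~R.

(* J - k h^(1)_1 for the rigging rt and the T^(1)_l-time t *)
Definition angle (rt : extrig mu) (l t k : nat) : 'cV[rat]_G :=
  rvec rt - 2^-1 *: pvec + t%:R *: hvec 1 (Some l) - k%:R *: hvec 1 (Some 1%N).

Definition carrier_theta (rt : extrig mu) (l t k a : nat) : rat :=
  let z := angle rt l t k in
  Theta (z + hvec a None)
  - Theta (z + hvec 1 (Some l) + hvec a None)
  - Theta (z + hvec a.-1 None)
  + Theta (z + hvec 1 (Some l) + hvec a.-1 None).

End Theta.

(* Number of letters a in T *)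
Definition letter_count (a : nat) (T : tableau) : nat := count_mem a (flatten T).

(* y t k is the carrier of type B^{1,l} at position k for the path
   q t = (T^(1)_l)^t (p), where rt represents Phi(p): the family y t is periodic,
   induces T^(1)_l on q t, and has the theta function coordinates.  The
   coordinate a = 1 is determined by the other ones, as y t k has l letters. *)
Definition is_carrier (n L : nat) (mu : 'I_n -> seq nat) (rt : extrig mu)
    (l : nat) (q : nat -> seq nat) (y : nat -> nat -> tableau) : Prop :=
  forall t,
    periodic_run n 1 l (q t) (q t.+1) (y t) /\
    (forall k a, (k <= L)%N -> (2 <= a <= n.+1)%N ->
       (letter_count a (y t k))%:R = carrier_theta L rt l t k a).

(* Main.v *)
(* By equivariance of Phi, T^N p = p says that r + N h, with h = h^(1)_l, is the
   image of r under some product of the s^(x)^(d_x).  Such a product acts on r,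
   up to permuting coordinates within the blocks of H, as r |-> r + B n for an
   integer vector n whose entries over the block x sum to d_x.  Theta is
   invariant under these permutations and quasi-periodic,
     Theta(z + B n) = Theta(z) + n^T B n / 2 + z^T n,
   so the sum of the carrier over 0 <= t < N, which telescopes, equals
   (h^(a-1)_oo - h^(a)_oo)^T n.  This only depends on the block averages d_x / m_x
   of n, which solve B nbar = N h.  The minimum in Theta is attained because B
   is positive definite: min and the Cartan matrix are both Gram matrices. *)
Require Import Defs.
From mathcomp Require Import all_boot all_order all_algebra.
From mathcomp Require Import fingroup perm boolp classical_sets ring lra zify.

Import Order.TTheory GRing.Theory Num.Theory.
Local Open Scope ring_scope.

(** * Gram decompositions of the Cartan matrix and of the minimum *)

Lemma sum_eq_pick (R : nzRingType) (m c : nat) (F : nat -> R) :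
  (c < m)%N -> \sum_(e < m) (c == e :> nat)%:R * F e = F c.
Proof.
move=> lt_cm; rewrite (bigD1 (Ordinal lt_cm)) //= eqxx mul1r big1 ?addr0 // => e.
by rewrite -val_eqE /= eq_sym => /negPf->; rewrite mul0r.
Qed.

(* The Cartan matrix of type A is the Gram matrix of the vectors
   eps_a - eps_(a-1), so it is positive semidefinite. *)
Lemma cartan_gram (n a b : nat) : (1 <= a <= n)%N -> (1 <= b <= n)%N ->
  cartan a b = \sum_(e < n.+1) ((a == e :> nat)%:R - (a == e.+1)%:R)
                             * ((b == e :> nat)%:R - (b == e.+1)%:R).
Proof.
case: a b => [|a] [|b] //= /= le_an le_bn.
(* The two indicators in the first factor pick out [e = a.+1] and [e = a]; both lie in the range
   because [a.+1 <= n]. *)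
transitivity (\sum_(e < n.+1)
     (((a.+1 == e :> nat)%:R * ((b.+1 == e :> nat)%:R - (b == e :> nat)%:R))
   - ((a == e :> nat)%:R * ((b.+1 == e :> nat)%:R - (b == e :> nat)%:R))) : int);
  last by apply: eq_bigr => e _; rewrite !eqSS mulrBl.
rewrite sumrB (@sum_eq_pick _ n.+1 a.+1 (fun e => (b.+1 == e)%:R - (b == e)%:R)) //.
rewrite (@sum_eq_pick _ n.+1 a (fun e => (b.+1 == e)%:R - (b == e)%:R)) 1?ltnW //.
rewrite /cartan !eqSS (eq_sym b a) (eq_sym b a.+1).
rewrite mulr_natl mulr2n (eq_sym a b.+1) /=; ring.
Qed.

(** The minimum counts the [k] below both numbers. Any bound [K >= a] will do, so one range can
    serve all row lengths. *)
Lemma minn_gram (R : nzRingType) (K a b : nat) : (a <= K)%N ->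
  (minn a b)%:R = \sum_(k < K) (k < a)%:R * (k < b)%:R :> R.
Proof.
move=> le_aK; transitivity ((minn K (minn a b))%:R : R).
  by congr (_%:R); lia.
elim: K {le_aK} => [|K IHK]; first by rewrite min0n big_ord0.
rewrite big_ord_recr /= -IHK -natrM -natrD; congr (_%:R); lia.
Qed.

Lemma cmin_sym (n : nat) (mu : 'I_n -> seq nat) (x y : Hbar mu) :
  cmin x y = cmin y x.
Proof. by rewrite /cmin minnC /cartan (eq_sym (color _)); congr (_ * _); ring. Qed.

(** * Positive definiteness of B *)

Section PositiveDefinite.
Variables (n L : nat) (mu : 'I_n -> seq nat).
Hypothesis hvac : forall x : Hbar mu, 1 <= vac L x.
Local Notation G := #|H mu|.
Local Notation B := (Bmx L mu).

Lemma BmxE i j : B i j = (i == j)%:R * (vac L (tag (triple i)))%:~R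
  + (cmin (tag (triple i)) (tag (triple j)))%:~R.
Proof.
rewrite mxE /=; move: (vac _ _) (cmin _ _) => v c.
by rewrite intrD intrM rmorph_nat.
Qed.

Lemma Bmx_sym : B^T = B.
Proof.
apply/matrixP => i j; rewrite mxE !BmxE cmin_sym; congr (_ + _).
by rewrite eq_sym; case: eqVneq => [->|_] //; rewrite !mul0r.
Qed.

(** An entrywise product of two Gram matrices is again a Gram matrix, so the form is a sum of
    squares indexed by [e] and [k]. *)
Lemma cmin_psd (u : 'I_G -> rat) :
  0 <= \sum_i \sum_j u i * u j * (cmin (tag (triple i)) (tag (triple j)))%:~R.
Proof.
pose K := (\max_i len (tag (triple i : H mu)))%N.
pose g e (x : Hbar mu) : int := (color x == e)%:R - (color x == e.+1)%:R.
pose w (k e : nat) i : rat :=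
  (g e (tag (triple i)))%:~R * (k < len (tag (triple i)))%:R.
have cminE i j : (cmin (tag (triple i)) (tag (triple j)))%:~R =
    \sum_(e < n.+1) \sum_(k < K) w k e i * w k e j.
  rewrite /cmin (@cartan_gram n) ?ltn_ord // intrM -pmulrn.
  rewrite (@minn_gram _ K); last first.
    exact: (leq_bigmax_cond (P := xpredT) (F := fun i => len (tag (triple i)))).
  rewrite rmorph_sum big_distrl /=; apply: eq_bigr => e _.
  rewrite big_distrr /=; apply: eq_bigr => k _.
  by rewrite /w /g rmorphM /=; ring.
rewrite [X in 0 <= X](_ : _ =
    \sum_(e < n.+1) \sum_(k < K) (\sum_i u i * w k e i) ^+ 2).
  by apply: sumr_ge0 => e _; apply: sumr_ge0 => k _; apply: sqr_ge0.
under eq_bigr => i _ do under eq_bigr => j _ do rewrite cminE big_distrr /=.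
under eq_bigr => i _ do rewrite exchange_big /=.
rewrite exchange_big /=; apply: eq_bigr => e _.
under eq_bigr => i _ do under eq_bigr => j _ do rewrite big_distrr /=.
under eq_bigr => i _ do rewrite exchange_big /=.
rewrite exchange_big /=; apply: eq_bigr => k _.
rewrite expr2 big_distrl /=; apply: eq_bigr => i _.
by rewrite big_distrr /=; apply: eq_bigr => j _; ring.
Qed.

(** The vacancy numbers are at least 1, so the diagonal part already dominates the sum of squares;
    the rest is nonnegative by [cmin_psd]. *)
Lemma Bmx_form (u : 'cV[rat]_G) :
  \sum_i u i 0 ^+ 2 <= (u^T *m B *m u) 0 0.
Proof.
have -> : (u^T *m B *m u) 0 0 = \sum_i (vac L (tag (triple i)))%:~R * u i 0 ^+ 2
    + \sum_i \sum_j u i 0 * u j 0 * (cmin (tag (triple i)) (tag (triple j)))%:~R.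
  rewrite -mulmxA mxE -big_split /=; apply: eq_bigr => i _.
  rewrite mxE [(B *m u) i 0]mxE.
  transitivity (\sum_j ((i == j)%:R * ((vac L (tag (triple i)))%:~R * u i 0 * u j 0)
     + u i 0 * u j 0 * (cmin (tag (triple i)) (tag (triple j)))%:~R)).
    rewrite big_distrr /=; apply: eq_bigr => j _.
    by rewrite BmxE; ring.
  rewrite big_split /=; congr (_ + _).
  rewrite (bigD1 i) //= eqxx mul1r big1 ?addr0 => [|j]; first by ring.
  by rewrite eq_sym => /negPf->; rewrite mul0r.
rewrite -[leLHS]addr0 lerD ?(cmin_psd (fun i => u i 0)) //.
apply: ler_sum => i _; rewrite ler_peMl ?sqr_ge0 //.
by rewrite -[1]/(1%:~R) ler_int.
Qed.

(** The form vanishes on the left kernel, so [Bmx_form] forces every kernel vector to be 0. *)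
Lemma Bmx_unit : B \in unitmx.
Proof.
rewrite -row_free_unit -kermx_eq0; apply/eqP/row_matrixP => i; rewrite row0.
set v := row i _; have vB : v *m B = 0.
  by apply/sub_kermxP; apply: row_sub.
have := Bmx_form v^T; rewrite trmxK vB mul0mx mxE => le0.
have /eqP : \sum_j v^T j 0 ^+ 2 = 0.
  by apply/eqP; rewrite eq_le le0 sumr_ge0 // => j _; apply: sqr_ge0.
rewrite psumr_eq0 => [/allP v0|j _]; last exact: sqr_ge0.
apply/rowP => j; have := v0 j (mem_index_enum _).
by rewrite mxE sqrf_eq0 => /eqP ->; rewrite mxE.
Qed.

(** * The theta function: attained minimum, quasi-periodicity, symmetry *)

Local Notation intmx m := (map_mx intr m).

Lemma theta_formE (z : 'cV[rat]_G) (m : 'cV[int]_G) : theta_form L z m =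
  2^-1 * ((intmx m)^T *m B *m intmx m) 0 0 + (z^T *m intmx m) 0 0.
Proof. by rewrite /theta_form mxE [X in X + _]mxE. Qed.

(** By symmetry of B, the shift by [B k] supplies the cross term of the quadratic form at [m + k];
    the terms in [k] alone remain. *)
Lemma theta_formB (z : 'cV[rat]_G) (m k : 'cV[int]_G) :
  theta_form L (z + B *m intmx k) m = theta_form L z (m + k) - theta_form L z k.
Proof.
have Bsym (x y : 'cV_G) : (x^T *m B *m y) 0 0 = (y^T *m B *m x) 0 0.
  transitivity ((x^T *m B *m y)^T 0 0); first by rewrite [RHS]mxE.
  by rewrite !trmx_mul trmxK Bmx_sym mulmxA.
rewrite !theta_formE !raddfD /= trmx_mul Bmx_sym.
move: (intmx m) (intmx k) => x y.
have split00 (M N : 'M[rat]_1) : (M + N) 0 0 = M 0 0 + N 0 0 by rewrite mxE.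
rewrite !(mulmxDl, mulmxDr) !split00 (Bsym y x); by field.
Qed.

(* The values of theta_form z are bounded below and have a common denominator. *)
Lemma theta_form_min (z : 'cV[rat]_G) :
  exists m, forall m', theta_form L z m <= theta_form L z m'.
Proof.
pose D : rat := \prod_i (denq (z i 0))%:~R.
have D0 : 0 < D by apply: prodr_gt0 => i _; rewrite ltr0z denq_gt0.
have Dz i : D * z i 0 \is a Num.int.
  rewrite /D (bigD1 i) //= mulrAC [_%:~R * _]mulrC -numqE.
  by rewrite rpredM ?intr_int ?rpred_prod // => j _; rewrite intr_int.
(* The factor 2 cancels the one half in the form, and [D] clears the denominators of [z]. *)
have intD m : 2 * D * theta_form L z m \is a Num.int.
  rewrite theta_formE.
  set q := (_ *m _ *m _) 0 0; set b := (_ *m _) 0 0.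
  have Dint : D \is a Num.int by apply: rpred_prod => i _; rewrite intr_int.
  have -> : 2 * D * (2^-1 * q + b) = D * q + 2 * (D * b) by field.
  rewrite rpredD // rpredM //.
    rewrite /q mxE rpred_sum // => j _.
    rewrite mxE rpredM ?mxE ?intr_int // rpred_sum // => i _.
    by rewrite !mxE rpredM ?intr_int.
  rewrite /b mxE big_distrr rpred_sum //= => i _.
  by rewrite mulrA !mxE rpredM ?intr_int.
(* By [Bmx_form] the value is at least the sum of [m_i^2/2 + z_i m_i], and each such term is at
   least [- z_i^2/2]. *)
have lb m : - 2^-1 * \sum_i z i 0 ^+ 2 <= theta_form L z m.
  have := Bmx_form (intmx m); rewrite theta_formE.
  set q := (_ *m _ *m _) 0 0 => le_q.
  apply: (@le_trans _ _ (2^-1 * \sum_i intmx m i 0 ^+ 2 + (z^T *m intmx m) 0 0)).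
    rewrite [(_ *m _) 0 0]mxE !big_distrr -big_split /=.
    apply: ler_sum => i _; rewrite [z^T _ _]mxE.
    have := sqr_ge0 (z i 0 + intmx m i 0).
    by move: (intmx m i 0) (z i 0) => u v; nra.
  by rewrite lerD2r ler_wpM2l.
(* Measured upwards from [c], the scaled values are natural numbers, so a least one exists. *)
pose c := Num.floor (2 * D * (- 2^-1 * \sum_i z i 0 ^+ 2)).
pose P k := `[< exists m, 2 * D * theta_form L z m = (c + k%:Z)%:~R >].
have D2 : 0 < 2 * D by rewrite mulr_gt0.
have toP m : exists2 k, P k & 2 * D * theta_form L z m = (c + k%:Z)%:~R.
  have /intrP[v vE] := intD m.
  have le_cv : c <= v.
    rewrite -(@intrKfloor rat v) le_floor // -vE ler_pM2l //; exact: lb.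
  have vk : v = c + (`|v - c|%N)%:Z by lia.
  by exists `|v - c|%N; [apply/asboolP; exists m; rewrite -vk|rewrite -vk].
have exP : exists k, P k by have [k Pk _] := toP 0; exists k.
case: (ex_minnP exP) => k /asboolP[m mE] kmin; exists m => m'.
have [k' Pk' k'E] := toP m'; rewrite -(ler_pM2l D2) mE k'E ler_int lerD2l.
exact: kmin.
Qed.

(** Two minima of the same form coincide, so [xget] has only one value to choose and its default 0
    is not reached. *)
Lemma ThetaE (z : 'cV[rat]_G) (m : 'cV[int]_G) :
  (forall m', theta_form L z m <= theta_form L z m') ->
  Theta L z = - theta_form L z m.
Proof.
move=> m_min; rewrite /Theta; congr (- _); apply: xget_unique.
  by split; [exists m|].
by move=> u [[m' <-] m'_min]; apply/eqP; rewrite eq_le m_min m'_min.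
Qed.

(** By [theta_formB], translating a minimizer by [- k] gives a minimizer of the shifted form. *)
Lemma ThetaDB (z : 'cV[rat]_G) (k : 'cV[int]_G) :
  Theta L (z + B *m intmx k) = Theta L z + theta_form L z k.
Proof.
have [m m_min] := theta_form_min z.
rewrite (@ThetaE z m) // (@ThetaE (z + B *m intmx k) (m - k)).
  by rewrite theta_formB subrK opprB addrC.
by move=> m'; rewrite !theta_formB subrK lerD2r.
Qed.

(** Permuting [z] and [m] together preserves the form, and permuting [m] is a bijection of the
    lattice. *)
Lemma Theta_perm (s : {perm 'I_G}) (z : 'cV[rat]_G) :
  (forall i j, B (s i) (s j) = B i j) -> Theta L (row_perm s z) = Theta L z.
Proof.
move=> Bs; have formE (w : 'cV[rat]_G) m :
    theta_form L (row_perm s w) (row_perm s m) = theta_form L w m.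
  rewrite !theta_formE; congr (_ * _ + _).
    rewrite -!mulmxA mxE [RHS]mxE [RHS](reindex_inj (@perm_inj _ s)) /=.
    apply: eq_bigr => i _; rewrite !mxE; congr (_ * _).
    rewrite [RHS](reindex_inj (@perm_inj _ s)) /=; apply: eq_bigr => j _.
    by rewrite Bs; congr (_ * _); rewrite !mxE.
  rewrite mxE [RHS]mxE [RHS](reindex_inj (@perm_inj _ s)) /=.
  by apply: eq_bigr => i _; rewrite !mxE.
have [m m_min] := theta_form_min z.
rewrite (@ThetaE z m) // (@ThetaE _ (row_perm s m)) ?formE // => m'.
have -> : m' = row_perm s (row_perm s^-1 m').
  by apply/colP => i; rewrite !mxE permK.
by rewrite !formE.
Qed.

End PositiveDefinite.

(** * Cyclic shift of one block by Euclidean division *)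

Section Rotation.
Variables (m : nat) (d : int).
Implicit Type i : 'I_m.

Lemma ord_dim_neq0 i : m%:Z != 0.
Proof. by case: i => i; lia. Qed.

Lemma ord_rot_proof i : (`|((i%:Z + d) %% m%:Z)%Z| < m)%N.
Proof.
have := ltz_mod (i%:Z + d) (ord_dim_neq0 i).
by have := modz_ge0 (i%:Z + d) (ord_dim_neq0 i); lia.
Qed.

Definition ord_rot i : 'I_m := Ordinal (ord_rot_proof i).

Definition ord_wind i : int := ((i%:Z + d) %/ m%:Z)%Z.

Lemma ord_rotE i : i%:Z + d = ord_wind i * m%:Z + (ord_rot i)%:Z.
Proof.
rewrite /= gez0_abs ?modz_ge0 ?ord_dim_neq0 //; exact: divz_eq.
Qed.

(** Indices with equal remainders differ by a multiple of [m], and their distance is less than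
    [m]. *)
Lemma ord_rot_inj : injective ord_rot.
Proof.
move=> i j eq_ij; have := ord_rotE i; have := ord_rotE j; rewrite eq_ij.
move: (ord_wind i) (ord_wind j) (ord_rot j) => u v r Ej Ei.
have Eij : i%:Z - j%:Z = (u - v) * m%:Z.
  by rewrite mulrBl; move: Ei Ej; move: (u * _) (v * _) => a b; lia.
apply: val_inj => /=; have [i_lt j_lt] := (ltn_ord i, ltn_ord j).
have : u - v = 0.
  by case: (ltrgt0P (u - v)) => // ?; nia.
by move=> uv; move: Eij; rewrite uv mul0r; lia.
Qed.

(** Summing [ord_rotE] over the block, the rotated indices are a permutation of the indices and
    cancel; this leaves [m d] equal to [m] times the sum. *)
Lemma sum_ord_wind : (0 < m)%N -> \sum_i ord_wind i = d.
Proof.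
move=> m_gt0; apply: (@mulIf _ (m%:Z)); first by lia.
have: \sum_(i < m) (i%:Z + d) = \sum_i (ord_wind i * m%:Z + (ord_rot i)%:Z).
  by apply: eq_bigr => i _; apply: ord_rotE.
rewrite !big_split /=.
rewrite [X in X + _ = _](reindex_inj ord_rot_inj) /=.
rewrite sumr_const card_ord -mulr_suml [RHS]addrC => /addrI <-.
by rewrite -mulr_natr natz.
Qed.

End Rotation.

(** * Shifts of riggings as integer translations by B *)

Section Quasiperiod.
Variables (n L : nat) (mu : 'I_n -> seq nat).
Local Notation G := #|H mu|.
Local Notation B := (Bmx L mu).
Local Notation intmx m := (map_mx intr m).

Lemma mult_gt0 (x : Hbar mu) : (0 < mult x)%N.
Proof.
rewrite /mult -has_count has_pred1 -mem_undup mem_nth //; exact: ltn_ord.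
Qed.

Lemma sum_triple (R : nmodType) (F : H mu -> R) :
  \sum_(i < G) F (triple i) = \sum_(x : Hbar mu) \sum_(b < mult x) F (Tagged _ b).
Proof.
rewrite sig_big_dep /= [RHS](reindex (@enum_val _ (H mu))) /=.
  by apply: eq_bigr => i _; rewrite /triple; case: (enum_val i).
by exists enum_rank => u _; rewrite ?enum_valK ?enum_rankK.
Qed.

Variable d : Hbar mu -> int.

(* s^(a)_i shifts the riggings of a block cyclically, adding the vacancy number
   at each wrap-around; [wind] counts the wrap-arounds after d shifts. *)
Definition rotate (u : H mu) : H mu := Tagged _ (ord_rot _ (d (tag u)) (tagged u)).

Lemma rotate_inj : injective rotate.
Proof.
move=> [x b] [y c] eq_rot; have xy : x = y by exact: (congr1 tag eq_rot).
move: c eq_rot; rewrite -{y}xy => c.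
by rewrite /rotate /= => /eqP; rewrite eq_Tagged /= => /eqP/ord_rot_inj->.
Qed.

Lemma rotate_index_inj :
  injective (fun i : 'I_G => enum_rank (rotate (triple i))).
Proof. by move=> i j /enum_rank_inj/rotate_inj/enum_val_inj. Qed.

Definition rotate_perm : {perm 'I_G} := perm rotate_index_inj.

Lemma triple_rotate i : triple (rotate_perm i) = rotate (triple i).
Proof. by rewrite /triple permE enum_rankK. Qed.

Lemma Bmx_rotate i j : B (rotate_perm i) (rotate_perm j) = B i j.
Proof. by rewrite !BmxE !triple_rotate (inj_eq perm_inj). Qed.

(** The vectors p and h have this form; the rotation fixes them, so it only moves the riggings. *)
Definition block (f : Hbar mu -> rat) : 'cV[rat]_G := \col_i f (tag (triple i)).

Lemma row_perm_block f : row_perm rotate_perm (block f) = block f.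
Proof. by apply/colP => i; rewrite !mxE triple_rotate. Qed.

Lemma hvecE c l : exists f, hvec mu c l = block f.
Proof.
exists (fun x => ((c == color x) * (if l is Some l' then minn l' (len x)
                                    else len x))%N%:R).
by apply/colP => i; rewrite !mxE.
Qed.

Lemma pvecE : pvec L mu = block (fun x => (vac L x)%:~R).
Proof. by apply/colP => i; rewrite !mxE. Qed.

Definition wind (u : H mu) : int := ord_wind _ (d (tag u)) (tagged u).

(** The integer vector n of the quasi-period. The inverse permutation is there because [rvec_rotate]
    rotates after adding [B n]. *)
Definition windvec : 'cV[int]_G :=
  row_perm rotate_perm^-1 (\col_i wind (triple i)).

Lemma windvecE i : windvec (rotate_perm i) 0 = wind (triple i).
Proof. by rewrite !mxE permK. Qed.

Lemma sum_wind (F : Hbar mu -> rat) :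
  \sum_i F (tag (triple i)) * (wind (triple i))%:~R = \sum_x F x * (d x)%:~R.
Proof.
rewrite (sum_triple _ (fun u => F (tag u) * (wind u)%:~R)).
apply: eq_bigr => x _; rewrite /= -big_distrr /= -rmorph_sum /wind /=.
by rewrite sum_ord_wind ?mult_gt0.
Qed.

(** The block averages nbar of [windvec]: each block sum is [d x], spread evenly over [mult x]
    entries. *)
Definition meanvec : 'cV[rat]_G := block (fun x => (d x)%:~R / (mult x)%:R).

Lemma sum_mean (F : Hbar mu -> rat) :
  \sum_i F (tag (triple i)) * meanvec i 0 = \sum_x F x * (d x)%:~R.
Proof.
under eq_bigr => i _ do rewrite mxE.
rewrite (sum_triple _ (fun u => F (tag u) * ((d (tag u))%:~R / (mult (tag u))%:R))).
apply: eq_bigr => x _; rewrite /= sumr_const card_ord -[LHS]mulr_natr -!mulrA.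
rewrite mulVf ?mulr1 //.
by rewrite pnatr_eq0 -lt0n mult_gt0.
Qed.

(** Pairing with a vector constant on blocks only sees block sums, which are [d x] on both sides. *)
Lemma wind_mean f : (intmx windvec)^T *m block f = meanvec^T *m block f.
Proof.
apply/matrixP => i0 j0; rewrite !ord1 mxE [RHS]mxE {i0 j0}.
rewrite (reindex_inj (@perm_inj _ rotate_perm)) /=.
transitivity (\sum_x f x * (d x)%:~R).
  rewrite -sum_wind; apply: eq_bigr => i _.
  by rewrite mxE [(map_mx _ _) _ _]mxE windvecE mxE triple_rotate mulrC.
rewrite -sum_mean; apply: eq_bigr => i _.
by rewrite [RHS]mulrC [_^T _ _]mxE [block f i 0]mxE.
Qed.

Variable rt : extrig mu.
Hypothesis rt_quasi : forall x alpha, rt x (alpha + (mult x)%:Z) = rt x alpha + vac L x.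

Lemma rt_quasi_int x alpha (c : int) :
  rt x (c * (mult x)%:Z + alpha) = rt x alpha + c * vac L x.
Proof.
elim/int_ind: c => [|c IH|c IH]; first by rewrite !mul0r add0r addr0.
  have -> : c.+1%:Z * (mult x)%:Z + alpha = c%:Z * (mult x)%:Z + alpha + (mult x)%:Z.
    by rewrite intS; ring.
  by rewrite rt_quasi IH intS; ring.
apply: (addIr (vac L x)); rewrite -rt_quasi.
have -> : - c.+1%:Z * (mult x)%:Z + alpha + (mult x)%:Z
    = - c%:Z * (mult x)%:Z + alpha by rewrite intS; ring.
by rewrite IH intS; ring.
Qed.

Lemma rt_shift x (b : 'I_(mult x)) :
  rt x (b.+1%:Z + d x) = rt x (ord_rot _ (d x) b).+1%:Z + ord_wind _ (d x) b * vac L x.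
Proof.
rewrite -rt_quasi_int; congr (rt x _).
by rewrite !intS -addrA ord_rotE addrCA.
Qed.

Variables (N : nat) (h : Hbar mu -> rat).
Hypothesis rt_period : forall x alpha,
  (rt x alpha)%:~R + N%:R * h x =
  (rt x (alpha + d x) + \sum_y d y * cmin y x)%:~R.

(** Each wrap-around adds a vacancy number, which is the diagonal part of [B n]; the [cmin] part
    depends only on the block sums [d y]. *)
Lemma rvec_rotate : row_perm rotate_perm (rvec rt + B *m intmx windvec)
  = rvec rt + N%:R *: block h.
Proof.
apply/colP => i; rewrite mxE mxE [RHS]mxE [(B *m _) _ _]mxE.
rewrite (reindex_inj (@perm_inj _ rotate_perm)) /=.
set x := tag (triple i).
have -> : \sum_j B (rotate_perm i) (rotate_perm j) * intmx windvec (rotate_perm j) 0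
    = (wind (triple i))%:~R * (vac L x)%:~R + (\sum_y d y * cmin y x)%:~R.
  transitivity (\sum_j ((i == j)%:R * ((vac L x)%:~R * (wind (triple j))%:~R)
                + (cmin x (tag (triple j)))%:~R * (wind (triple j))%:~R) : rat).
    by apply: eq_bigr => j _; rewrite Bmx_rotate BmxE mxE windvecE; ring.
  rewrite big_split /= (bigD1 i) //= eqxx mul1r big1 ?addr0 => [|j]; last first.
    by rewrite eq_sym => /negPf->; rewrite mul0r.
  rewrite (sum_wind (fun y => (cmin x y)%:~R)) mulrC rmorph_sum; congr (_ + _).
  by apply: eq_bigr => y _; rewrite rmorphM /= mulrC cmin_sym.
rewrite !mxE triple_rotate -/x rt_period intrD rt_shift.
by rewrite intrD intrM addrA.
Qed.

Lemma Bmx_mean : B *m meanvec = N%:R *: block h.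
Proof.
apply/colP => i; rewrite mxE [RHS]mxE [block h i 0]mxE; set x := tag (triple i).
have -> : \sum_j B i j * meanvec j 0
    = (vac L x)%:~R * ((d x)%:~R / (mult x)%:R) + (\sum_y d y * cmin y x)%:~R.
  transitivity (\sum_j ((i == j)%:R * ((vac L x)%:~R * meanvec j 0)
                + (cmin x (tag (triple j)))%:~R * meanvec j 0)).
    by apply: eq_bigr => j _; rewrite BmxE; ring.
  rewrite big_split /= (bigD1 i) //= eqxx mul1r big1 ?addr0 => [|j]; last first.
    by rewrite eq_sym => /negPf->; rewrite mul0r.
  rewrite (sum_mean (fun y => (cmin x y)%:~R)) mxE rmorph_sum; congr (_ + _).
  by apply: eq_bigr => y _; rewrite rmorphM /= mulrC cmin_sym.
have m_neq0 : (mult x)%:R != 0 :> rat by rewrite pnatr_eq0 -lt0n mult_gt0.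
apply: (mulfI m_neq0).
(* Averaging the period relation over a block: the rotation permutes the riggings, so they cancel,
   and the wrap-arounds add up to [d x]. *)
have: \sum_(b < mult x) ((rt x b.+1%:Z)%:~R + N%:R * h x) =
      \sum_(b < mult x) ((rt x (ord_rot _ (d x) b).+1%:Z)%:~R
        + (ord_wind _ (d x) b)%:~R * (vac L x)%:~R
        + (\sum_y d y * cmin y x)%:~R).
  by apply: eq_bigr => b _; rewrite rt_period rt_shift 2![in LHS]intrD intrM.
rewrite !big_split /= (reindex_inj (@ord_rot_inj _ (d x))) /= -addrA => /addrI.
rewrite !sumr_const card_ord -mulr_suml -rmorph_sum sum_ord_wind ?mult_gt0 //=.
rewrite -(mulr_natl (N%:R * h x)) -(mulr_natl (\sum_y _)%:~R) => ->.
by field.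
Qed.

End Quasiperiod.

(** * Riggings along the time evolution, and the sum over a period *)

Section Orbit.
Variables (n L : nat) (mu : 'I_n -> seq nat).
Hypothesis hvac : forall x : Hbar mu, 1 <= vac L x.
Implicit Types (p : seq nat) (rt : extrig mu).

Lemma Tevol_inj_r r l p q1 q2 : Tevol n r l p q1 -> Tevol n r l p q2 -> q1 = q2.
Proof.
by move=> [[_ unique_p] [v1 run1]] [_ [v2 run2]]; have [] := unique_p _ _ _ _ run1 run2.
Qed.

(** The generators of both groups only shift [alpha] or add terms independent of it, so
    quasi-periodicity survives from [iota_KKR]. *)
Lemma Phi_quasi p rt x alpha : Phi L p rt ->
  rt x (alpha + (mult x)%:Z) = rt x alpha + vac L x.
Proof.
move=> [t [pp [rt0 [_ _ _ [inJ _ _] [d dE]]]]].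
rewrite !dE /Aact addrAC.
have -> : forall b, Tact t rt0 x (b + (mult x)%:Z) = Tact t rt0 x b + vac L x.
  elim: t {dE} => [|[[a l] pos] t IH] b /=; first by have [] := inJ x b.
  by rewrite IH addrAC.
by rewrite addrAC.
Qed.

Lemma Tact_nseq N a l rt x alpha : Tact (nseq N (a, l, true)) rt x alpha =
  rt x alpha + N%:R * ((a == color x)%:R * (minn l (len x))%:Z).
Proof.
elim: N => [|N IHN] /=; first by rewrite mul0r addr0.
by rewrite IHN expr0 -natr1; ring.
Qed.

Lemma Tact_path_nseq a l (q : nat -> seq nat) N : (1 <= a <= n)%N -> (1 <= l)%N ->
  LC_stable L mu -> inP L mu (q 0%N) -> (forall t, Tevol n a l (q t) (q t.+1)) ->
  Tact_path L mu (nseq N (a, l, true)) (q 0%N) (q N).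
Proof.
move=> a_n l_gt0 stable q0P q_step.
(* Stability yields some image in P(mu), and uniqueness of the evolution identifies it with
   [q t.+1]. *)
have qP t : inP L mu (q t).
  elim: t => // t IHt; have [/(_ _ IHt) [q' q'P q_q'] _] := stable a l a_n l_gt0.
  by rewrite (Tevol_inj_r _ _ _ _ _ (q_step t) q_q').
by elim: N => [|N IHN] //=; exists (q N).
Qed.

Lemma sum_carrier_theta rt l N k a (d : Hbar mu -> int) :
  (forall x alpha, rt x (alpha + (mult x)%:Z) = rt x alpha + vac L x) ->
  (forall x alpha, rt x alpha + N%:R * ((1%N == color x)%:R * (minn l (len x))%:Z)
     = rt x (alpha + d x) + \sum_y d y * cmin y x) ->
  \sum_(t < N) carrier_theta L rt l t k a =
  N%:R * ((hvec mu 1 (Some l))^T *m invmx (Bmx L mu)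
     *m (hvec mu a.-1 None - hvec mu a None)) 0 0.
Proof.
move=> rt_quasi rt_period.
pose h (x : Hbar mu) : rat := ((1%N == color x) * minn l (len x))%N%:R.
have hE : hvec mu 1 (Some l) = block n mu h by apply/colP => i; rewrite !mxE.
have periodQ x alpha : (rt x alpha)%:~R + N%:R * h x =
    (rt x (alpha + d x) + \sum_y d y * cmin y x)%:~R.
  by rewrite -rt_period rmorphD rmorphM /= /h natrM !rmorphM /= !rmorph_nat -pmulrn.
pose w : 'cV[rat]_(#|H mu|) := map_mx intr (windvec n mu d).
pose s := rotate_perm n mu d.
(* Advancing time by one adds [hvec 1 (Some l)] to the angle, so the carrier is [F t - F t.+1]. *)
pose F t := Theta L (angle L rt l t k + hvec mu a None)
          - Theta L (angle L rt l t k + hvec mu a.-1 None).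
have angleS t : angle L rt l t.+1 k = angle L rt l t k + hvec mu 1 (Some l).
  rewrite /angle -[t.+1%:R]natr1 scalerDl scale1r.
  by apply/colP => i; rewrite !mxE; ring.
(* Everything in the angle except [rvec] is constant on blocks, so [rvec_rotate] extends to the
   whole argument of [Theta]. *)
have rot_angle c : angle L rt l N k + hvec mu c None =
    row_perm s (angle L rt l 0 k + hvec mu c None + Bmx L mu *m w).
  have [f fE] := hvecE n mu c None; have [f1 f1E] := hvecE n mu 1 (Some 1%N).
  have := rvec_rotate n L mu d rt rt_quasi N h periodQ.
  rewrite /angle fE f1E pvecE hE => rot.
  have rowD (u v : 'cV[rat]_(#|H mu|)) : row_perm s (u + v) = row_perm s u + row_perm s v.
    by rewrite raddfD.
  have rowN (u : 'cV[rat]_(#|H mu|)) : row_perm s (- u) = - row_perm s u.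
    by rewrite raddfN.
  have rowZ c' (u : 'cV[rat]_(#|H mu|)) : row_perm s (c' *: u) = c' *: row_perm s u.
    by rewrite linearZ.
  move: rot; rewrite !(rowD, rowN, rowZ) !row_perm_block scale0r addr0.
  move: (row_perm s _) (row_perm s _) => u v uv.
  have -> : v = rvec rt + N%:R *: block n mu h - u by rewrite -uv addrK.
  by apply/colP => i; rewrite !mxE; ring.
have add00 (u v : 'M[rat]_1) : (u + v) 0 0 = u 0 0 + v 0 0 by rewrite mxE.
have opp00 (u : 'M[rat]_1) : (- u) 0 0 = - u 0 0 by rewrite mxE.
have trD (u v : 'cV[rat]_(#|H mu|)) : (u + v)^T = u^T + v^T by rewrite raddfD.
have trB (u v : 'cV[rat]_(#|H mu|)) : (u - v)^T = u^T - v^T by rewrite raddfB.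
(* The quadratic terms from [ThetaDB] agree for [a] and [a.-1] and cancel, as does the common angle;
   only a term linear in [w] is left. *)
have FN : F 0%N - F N = ((hvec mu a.-1 None - hvec mu a None)^T *m w) 0 0.
  rewrite /F !rot_angle !(Theta_perm _ _ _ hvac); try exact: Bmx_rotate.
  rewrite !(ThetaDB _ _ _ hvac) !theta_formE -/w.
  by rewrite trB !trD mulmxBl !mulmxDl !add00 opp00; ring.
transitivity (F 0%N - F N).
  rewrite -opprB -telescope_sumr // big_mkord -sumrN.
  by apply: eq_bigr => t _; rewrite /carrier_theta /F angleS; ring.
have [fa faE] := hvecE n mu a None; have [fb fbE] := hvecE n mu a.-1 None.
have BN := Bmx_mean n L mu d rt rt_quasi N h periodQ.
transitivity ((w^T *m (hvec mu a.-1 None - hvec mu a None)) 0 0).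
  by rewrite FN -[in RHS](trmxK (_ - _)) -trmx_mul [RHS]mxE.
(* Here [w] may be replaced by its block averages, for which [BN] can be solved by inverting B. *)
rewrite mulmxBr faE fbE !wind_mean -mulmxBr.
transitivity ((N%:R *: ((block n mu h)^T *m invmx (Bmx L mu)
  *m (block n mu fb - block n mu fa))) 0 0); last by rewrite hE mxE.
rewrite !scalemxAl -linearZ /= -BN trmx_mul Bmx_sym mulmxK //.
exact: Bmx_unit.
Qed.

End Orbit.

Theorem proposition4p4 (n L : nat) (hn : (1 <= n)%N) (hL : (1 <= L)%N)
  (hLC : linearization_conjecture n L)
  (mu : 'I_n -> seq nat) (hmu : young_tuple mu)
  (hvac : forall x : Hbar mu, 1 <= vac L x)
  (p : seq nat) (hp : inP L mu p)
  (l : nat) (hl : (1 <= l)%N)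
  (* q t is the path (T^(1)_l)^t (p) *)
  (q : nat -> seq nat) (hq0 : q 0%N = p)
  (hq : forall t, Tevol n 1 l (q t) (q t.+1))
  (N : nat) (hN0 : (0 < N)%N) (hNp : q N = p)
  (hNmin : forall M : nat, (0 < M)%N -> q M = p -> (N <= M)%N)
  (rt : extrig mu) (hrt : Phi L p rt)
  (y : nat -> nat -> tableau) (hy : is_carrier L rt l q y)
  (k a : nat) (hk : (k <= L)%N) (ha : (2 <= a <= n.+1)%N) :
  N%:R^-1 * (\sum_(t < N) (letter_count a (y t k))%:R) =
  ((hvec mu 1 (Some l))^T *m invmx (Bmx L mu)
     *m (hvec mu a.-1 None - hvec mu a None)) 0 0.
Proof.
have [stable _ [well_def _ _ equivar]] := hLC mu hmu hvac.
have one_n : (1 <= 1 <= n)%N by rewrite hn.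
have q0P : inP L mu (q 0%N) by rewrite hq0.
have path_p := Tact_path_nseq n L mu 1 l q N one_n hl stable q0P hq.
rewrite hNp hq0 in path_p.
have wf : Tword_wf n (nseq N (1%N, l, true)).
  by apply/allP => g /nseqP[-> _] /=; rewrite hn hl.
(* Since [q N = p], both [rt] and its N-fold translate represent Phi(p); well-definedness yields the
   shift exponents [d]. *)
have [_ /(_ _ _ hrt (equivar _ _ _ _ wf path_p hrt)) [d dE]] := well_def p hp.
rewrite (eq_bigr (fun t : 'I_N => carrier_theta L rt l t k a)); last first.
  by move=> t _; have [_ ->] := hy t.
rewrite (sum_carrier_theta n L mu hvac rt l N k a d).
- by rewrite mulKf // pnatr_eq0 -lt0n.
- by move=> x alpha; exact: Phi_quasi hrt.
- by move=> x alpha; rewrite -Tact_nseq dE.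
Qed.
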